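(* Let $G$ and $H$ be graphs. Let $\mathcal{F}$ be a collection of graphs such that: (1) $F \to (G,H)$ for every $F \in \mathcal{F}$; (2) every graph $\Gamma$ with $\Gamma \to (G,H)$ contains some graph $F \in \mathcal{F}$; (3) for every two different $F_1,F_2 \in \mathcal{F}$, neither of $F_1$, $F_2$ contains the other. Then: (i) $\mathcal{R}(G,H) = \{F \in \mathcal{F} : F \text{ is not self-embeddable}\}$; (ii) $\mathcal{R}(G,H)$ is empty if and only if every $F \in \mathcal{F}$ is self-embeddable.
   Context: All graphs are simple, countable (finite or countably infinite), and have no isolated vertices; collections of graphs are considered up to isomorphism. A subgraph $H$ of $G$ has $V(H)\subseteq V(G)$ and $E(H)\subseteq E(G)$; it is proper if $E(H)$ is a proper subset of $E(G)$. A graph $G$ (properly) contains $H$ if some (proper) subgraph of $G$ is isomorphic to $H$. A graph is self-embeddable if it properly contains itself, i.e. it is isomorphic to one of its proper subgraphs. We write $F \to (G,H)$ if every red-blue coloring of the edges of $F$ produces a subgraph isomorphic to $G$ with all edges red or a subgraph isomorphic to $H$ with all edges blue. A graph $F$ is $(G,H)$-minimal if $F \to (G,H)$ and no proper subgraph $F'$ of $F$ satisfies $F' \to (G,H)$. $\mathcal{R}(G,H)$ denotes the collection of all $(G,H)$-minimal graphs. *)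

(* Defs.v *)
From HB Require Import structures.
From mathcomp Require Import all_boot.

Set Implicit Arguments.
Unset Strict Implicit.
Unset Printing Implicit Defensive.

(* The null graph is allowed. *)
Record graph := Graph {
  vertex :> countType;
  adj : rel vertex;
  adj_sym : symmetric adj;
  adj_irr : irreflexive adj;
  adj_noniso : forall x, exists y, adj x y
}.

(* Subgraphs, like all graphs here, have no isolated vertices. *)
Record subgraph (G : graph) := Subgraph {
  sub_vertex : pred G;
  sub_edge : rel G;
  sub_edge_adj : subrel sub_edge (@adj G);
  sub_edge_sym : symmetric sub_edge;
  sub_edge_vertex : forall x y, sub_edge x y -> sub_vertex x && sub_vertex y;
  sub_noniso : forall x, sub_vertex x -> exists y, sub_edge x y
}.

Section GraphOfSubgraph.
Variables (G : graph) (S : subgraph G).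

Definition sg_vertex : countType := {x : G | sub_vertex S x}.
Definition sg_adj : rel sg_vertex := fun u v => sub_edge S (val u) (val v).

Fact sg_adj_sym : symmetric sg_adj.
Proof. by move=> u v; apply: sub_edge_sym. Qed.

Fact sg_adj_irr : irreflexive sg_adj.
Proof.
move=> u; apply/negP => /(@sub_edge_adj _ S).
by rewrite adj_irr.
Qed.

Fact sg_adj_noniso (u : sg_vertex) : exists v, sg_adj u v.
Proof.
have [y uy] := sub_noniso (valP u).
have /andP[_ Sy] := sub_edge_vertex uy.
by exists (Sub y Sy); rewrite /sg_adj SubK.
Qed.

Definition graph_of_subgraph : graph :=
  Graph sg_adj_sym sg_adj_irr sg_adj_noniso.
End GraphOfSubgraph.

Coercion graph_of_subgraph : subgraph >-> graph.

(* Properness is about edge sets: E(S) is a proper subset of E(G). *)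
Definition proper_subgraph (G : graph) (S : subgraph G) : Prop :=
  ~ subrel (@adj G) (sub_edge S).

Definition isomorphic (G H : graph) : Prop :=
  exists2 f : G -> H, bijective f & {mono f : x y / adj x y}.

Definition contains (G H : graph) : Prop :=
  exists S : subgraph G, isomorphic S H.

Definition properly_contains (G H : graph) : Prop :=
  exists2 S : subgraph G, proper_subgraph S & isomorphic S H.

Definition self_embeddable (G : graph) : Prop := properly_contains G G.

(* A red-blue coloring of E(F) is a symmetric [c : rel F], with [true] for red;
   its values off the edges of F are irrelevant. *)
Definition arrows (F G H : graph) : Prop :=
  forall c : rel F, symmetric c ->
    (exists2 S : subgraph F,
       isomorphic S G & forall x y, sub_edge S x y -> c x y)
    \/ (exists2 S : subgraph F,
       isomorphic S H & forall x y, sub_edge S x y -> ~~ c x y).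

Definition ramsey_minimal (G H F : graph) : Prop :=
  arrows F G H /\
  forall S : subgraph F, proper_subgraph S -> ~ arrows S G H.

(* A collection is any predicate on graphs (closed under isomorphism or not);
   it stands for the isomorphism classes that it meets. *)
Definition collection := graph -> Prop.

Definition same_collection (A B : collection) : Prop :=
  forall X : graph,
    (exists2 Y, A Y & isomorphic X Y) <-> (exists2 Y, B Y & isomorphic X Y).

Definition empty_collection (A : collection) : Prop := forall X, ~ A X.

Definition ramsey_collection (G H : graph) : collection := ramsey_minimal G H.

(* Main.v *)
(* A minimal graph contains some F in the collection, and the copy of F cannot
   be proper, so it is the whole graph; conversely, if a proper subgraph of F
   arrows (G, H), it contains some F' in the collection, which is F by the
   antichain condition, so that F is self-embeddable. *)
Require Import Defs.
From mathcomp Require Import all_boot.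
From mathcomp Require Import boolp.

Set Implicit Arguments.
Unset Strict Implicit.
Unset Printing Implicit Defensive.

Lemma isomorphic_refl (G : graph) : isomorphic G G.
Proof. by exists id => //; exists id. Qed.

Lemma isomorphic_sym (G H : graph) : isomorphic G H -> isomorphic H G.
Proof.
case=> f [g fK gK] f_mono; exists g; first by exists f.
by move=> x y; rewrite -f_mono !gK.
Qed.

Lemma isomorphic_trans (G H K : graph) :
  isomorphic G H -> isomorphic H K -> isomorphic G K.
Proof.
case=> f f_bij f_mono [g g_bij g_mono]; exists (g \o f); first exact: bij_comp.
by move=> x y; rewrite /= g_mono f_mono.
Qed.

(** The image carries only the edges coming from [X], not all those that [F] induces, so [f] need
    not reflect adjacency. This is the tool for moving copies between graphs; the second conclusion
    bounds the edges of the copy. *)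
Lemma image_subgraph (X F : graph) (f : X -> F) :
    injective f -> {homo f : x y / adj x y} ->
  exists2 S : subgraph F, isomorphic X S &
    forall x y, sub_edge S x y -> exists u v, [/\ x = f u, y = f v & adj u v].
Proof.
move=> f_inj f_homo.
(* The boolean [==] lets [xchoose] pick preimages below, which yields the inverse of [f] on its
   image. *)
pose V x := `[< exists u, f u == x >].
pose E x y := `[< exists u v, [/\ x = f u, y = f v & adj u v] >].
have E_adj : subrel E (@adj F).
  by move=> x y /asboolP[u [v [-> -> /f_homo]]].
have E_sym : symmetric E.
  by move=> x y; apply/asboolP/asboolP => -[u [v [-> -> uv]]];
     exists v, u; rewrite adj_sym.
have E_V x y : E x y -> V x && V y.
  move=> /asboolP[u [v [-> -> _]]].
  by apply/andP; split; apply/asboolP; [exists u | exists v].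
have V_noniso x : V x -> exists y, E x y.
  move=> /asboolP[u /eqP <-]; have [v uv] := adj_noniso u.
  by exists (f v); apply/asboolP; exists u, v.
exists (Subgraph E_adj E_sym E_V V_noniso); last first.
  by move=> x y /asboolP.
have fV u : V (f u) by apply/asboolP; exists u.
pose g (s : {x | V x}) := xchoose (asboolW (valP s)).
have gP s : f (g s) = val s by apply/eqP/(xchooseP (asboolW (valP s))).
exists (fun u => Sub (f u) (fV u) : {x | V x}).
  exists g => [u|s]; first by apply: f_inj; rewrite gP SubK.
  by apply: val_inj; rewrite SubK gP.
move=> u v; apply/asboolP/idP; last by exists u, v.
by move=> [u' [v' [/f_inj -> /f_inj ->]]].
Qed.

(** A coloring of [F'] is pulled back along [f], and the monochromatic copy found in [F] is pushed
    forward. *)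
Lemma arrows_isomorphic (F F' G H : graph) :
  isomorphic F F' -> arrows F G H -> arrows F' G H.
Proof.
case=> f f_bij f_mono FGH c c_sym.
(* [P] stands for either color, so that one argument serves red and blue. *)
have copy K (P : rel F') (S : subgraph F) : isomorphic S K ->
    (forall x y, sub_edge S x y -> P (f x) (f y)) ->
  exists2 S' : subgraph F',
    isomorphic S' K & forall x y, sub_edge S' x y -> P x y.
  move=> SK SP; have [|u v uv|S' SS' S'E] := @image_subgraph S F' (f \o val).
  - exact: inj_comp (bij_inj f_bij) val_inj.
  - by rewrite /= f_mono; apply: sub_edge_adj uv.
  exists S'; first exact: isomorphic_trans (isomorphic_sym SS') SK.
  by move=> _ _ /S'E[u [v [-> -> /SP]]].
case: (FGH (fun x y => c (f x) (f y))) => [x y|[S SG Sc]|[S SH Sc]].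
- exact: c_sym.
- by left; apply: copy SG Sc.
- by right; apply: (copy _ (fun x y => ~~ c x y)) SH Sc.
Qed.

(** The image of [S] under [f] is again proper: if it had all edges of [F'], injectivity of [f]
    would give [S] all edges of [F]. *)
Lemma properly_contains_isomorphic (F F' X X' : graph) :
    isomorphic F F' -> isomorphic X X' ->
  properly_contains F X -> properly_contains F' X'.
Proof.
case=> f f_bij f_mono XX' [S S_proper SX].
have f_inj := bij_inj f_bij.
have [|u v uv|S' SS' S'E] := @image_subgraph S F' (f \o val).
- exact: inj_comp f_inj val_inj.
- by rewrite /= f_mono; apply: sub_edge_adj uv.
exists S'; last first.
  exact: isomorphic_trans (isomorphic_sym SS') (isomorphic_trans SX XX').
move=> S'_full; apply: S_proper => x y.
by rewrite -f_mono => /S'_full/S'E[u [v [/f_inj -> /f_inj ->]]].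
Qed.

(** Seen in [F], the copy [T] uses only edges of [S], so it misses whatever edge [S] misses, even if
    [T] is all of [S]. *)
Lemma properly_contains_sub (F X : graph) (S : subgraph F) :
  proper_subgraph S -> contains S X -> properly_contains F X.
Proof.
move=> S_proper [T TX].
have [|u v uv|S' TS' S'E] := @image_subgraph T F (val \o val).
- exact: inj_comp val_inj val_inj.
- exact: sub_edge_adj (sub_edge_adj uv).
exists S'; last exact: isomorphic_trans (isomorphic_sym TS') TX.
move=> S'_full; apply: S_proper => x y /S'_full/S'E[u [v [-> -> uv]]].
exact: (sub_edge_adj uv).
Qed.

(* Without isolated vertices, a subgraph with all edges has all vertices. *)
Lemma full_subgraph_isomorphic (F : graph) (S : subgraph F) :
  ~ proper_subgraph S -> isomorphic S F.
Proof.
move=> /contrapT S_full.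
have SV x : sub_vertex S x.
  by have [y /S_full/sub_edge_vertex/andP[]] := adj_noniso x.
exists val.
  by exists (fun x => Sub x (SV x)) => [u|x]; [apply: val_inj | ]; rewrite SubK.
by move=> u v; apply/idP/idP => [/S_full|/sub_edge_adj].
Qed.

(** A proper copy of [F] inside [F] would arrow as [F] does, against minimality. *)
Lemma ramsey_minimal_not_self_embeddable (G H F : graph) :
  ramsey_minimal G H F -> ~ self_embeddable F.
Proof.
case=> FGH F_min [S S_proper SF]; apply: F_min S_proper _.
exact: arrows_isomorphic (isomorphic_sym SF) FGH.
Qed.

Theorem theorem11 (G H : graph) (FF : collection)
  (FF_arrows : forall F, FF F -> arrows F G H)
  (FF_cover : forall Gamma : graph, arrows Gamma G H ->
     exists2 F, FF F & contains Gamma F)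
  (FF_antichain : forall F1 F2, FF F1 -> FF F2 -> ~ isomorphic F1 F2 ->
     ~ contains F1 F2 /\ ~ contains F2 F1) :
  same_collection (ramsey_collection G H)
    (fun F => FF F /\ ~ self_embeddable F)
  /\ (empty_collection (ramsey_collection G H) <->
      forall F, FF F -> self_embeddable F).
Proof.
(* [FF] may not be closed under isomorphism, so [Y] is only matched with an isomorphic member. *)
have minimal_FF Y : ramsey_minimal G H Y ->
    exists2 F, FF F /\ ~ self_embeddable F & isomorphic Y F.
  move=> Y_min; have [YGH noS] := Y_min.
  have [F FF_F [S SF]] := FF_cover Y YGH.
  have SY : isomorphic S Y.
    apply: full_subgraph_isomorphic => /noS; apply.
    exact: arrows_isomorphic (isomorphic_sym SF) (FF_arrows F FF_F).
  have FY := isomorphic_trans (isomorphic_sym SF) SY.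
  exists F; last exact: isomorphic_sym.
  split=> // F_emb; apply: (ramsey_minimal_not_self_embeddable Y_min).
  exact: properly_contains_isomorphic F_emb.
have FF_minimal F : FF F -> ~ self_embeddable F -> ramsey_minimal G H F.
  move=> FF_F F_nemb; split; first exact: FF_arrows.
  move=> S S_proper /FF_cover[F' FF_F' SF'].
  have FF' := properly_contains_sub S_proper SF'.
  (* Different members means non-isomorphic ones: the antichain condition excludes that case, and
     otherwise the proper copy of [F'] is a proper copy of [F]. *)
  have [F_iso|F_niso] := pselect (isomorphic F F').
    apply: F_nemb; apply: properly_contains_isomorphic FF'.
      exact: isomorphic_refl.
    exact: isomorphic_sym.
  have [nFF' _] := FF_antichain _ _ FF_F FF_F' F_niso.
  by have [T _ TF'] := FF'; apply: nFF'; exists T.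
split=> [X|]; split.
- move=> [Y /minimal_FF[F FF_F YF] XY]; exists F => //.
  exact: isomorphic_trans YF.
- by move=> [F [FF_F F_nemb] XF]; exists F => //; apply: FF_minimal.
- move=> R0 F FF_F; apply: contrapT => F_nemb.
  exact: R0 (FF_minimal F FF_F F_nemb).
- by move=> all_emb X /minimal_FF[F [/all_emb]].
Qed.
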